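(* Let $\mathcal{T}=(T,C)$ be a triangulation. Then the space of drawings $X(\mathcal{T})$ is an irreducible algebraic variety over $\mathbb{C}$.
   Context: Let $T$ be a finite oriented 2-dimensional simplicial complex whose underlying space is homeomorphic to a closed disk, with vertex set $\mathrm{Vert}(T)$. Its boundary vertices $P_1,\dots,P_n$, listed in cyclic order, are called corners; $\partial T$ denotes the set of corners; the other vertices are interior vertices. For a set $S$ of triangles of $T$, $\mathrm{Vert}(S)$ is the set of vertices of triangles of $S$; $S$ is contiguous if the graph $S^*$, with one vertex per triangle of $S$ and an edge for each pair of triangles of $S$ sharing an edge, is connected. A condition is a set $C\subset \mathrm{Vert}(T)$ such that $C=\mathrm{Vert}(S)$ for some contiguous set of triangles $S$ and $|C\cap\partial T|\le 2$; $C=\emptyset$ is allowed. A triangulation is a pair $\mathcal{T}=(T,C)$ with $T$ a finite oriented 2-dimensional simplicial complex whose underlying space is homeomorphic to a closed disk and $C$ a (possibly empty) condition. $X(\mathcal{T})$ is the set of all maps $\rho:\mathrm{Vert}(T)\to\mathbb{C}^2$ such that there is an affine line $\ell\subset\mathbb{C}^2$ containing $\rho(v)$ for every $v\in C$. It is a Zariski closed subset of the affine space of all maps $\mathrm{Vert}(T)\to\mathbb{C}^2$. Elements of $X(\mathcal{T})$ are called drawings. *)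

(* Defs.v *)
From HB Require Import structures.
From mathcomp Require Import all_boot all_order all_algebra.
From mathcomp Require Import all_classical all_reals all_analysis.
From mathcomp Require Import complex.
(* The notations of mpoly clash with those of MathComp-Analysis. *)
From mathcomp Require Import -(notations) mpoly.

Set Implicit Arguments.
Unset Strict Implicit.
Unset Printing Implicit Defensive.

Import Order.TTheory GRing.Theory Num.Theory.
Import numFieldNormedType.Exports.

Local Open Scope classical_set_scope.
Local Open Scope ring_scope.

(* [f] and [g] are total functions, but only their restrictions to [A] and [B]
   matter: these are mutually inverse homeomorphisms for the subspace
   topologies. *)
Record homeomorphism {X Y : topologicalType} (A : set X) (B : set Y)
    (f : X -> Y) (g : Y -> X) : Prop := Homeomorphism {
  homeo_fun : forall x, A x -> B (f x);
  homeo_inv : forall y, B y -> A (g y);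
  homeo_funK : forall x, A x -> g (f x) = x;
  homeo_invK : forall y, B y -> f (g y) = y;
  homeo_fun_continuous : {within A, continuous f};
  homeo_inv_continuous : {within B, continuous g} }.

Definition closed_disk (R : realType) : set (R * R) :=
  [set p | p.1 ^+ 2 + p.2 ^+ 2 <= 1].

Definition unit_circle (R : realType) : set (R * R) :=
  [set p | p.1 ^+ 2 + p.2 ^+ 2 = 1].

(* The geometric realization of an abstract simplicial complex, in barycentric
   coordinates; [V] being finite, the topology of pointwise convergence on
   [V -> R] is the usual one. *)
Definition realization (R : realType) (V : finType) (F : {set {set V}}) :
    set {ptws V -> R} :=
  [set x | [/\ forall v, 0 <= x v, \sum_v x v = 1 &
               [set v | x v != 0]%SET \in F]].

Definition vertex_point (R : realType) (V : finType) (v : V) : {ptws V -> R} :=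
  fun u => (u == v)%:R.

(* Finite oriented 2-dimensional simplicial complexes whose underlying space is
   a closed disk. Simplices are given by their (nonempty) sets of vertices. The
   orientation is given by the triples [(a, b, c)] listing the vertices of a
   triangle in positive cyclic order; coherence says that two triangles sharing
   an edge induce opposite directions on it, i.e., that no directed edge
   [(a, b)] belongs to two positively oriented triangles. *)
Record oriented_disk (R : realType) := OrientedDisk {
  Vert : finType;
  faces : {set {set Vert}};
  positive : Vert -> Vert -> Vert -> bool;
  faces_neq0 : finset.set0 \notin faces;
  faces_vertex : forall v, [set v]%SET \in faces;
  faces_closed : forall s t : {set Vert},
    s \in faces -> t \subset s -> t != finset.set0 -> t \in faces;
  faces_dim2 : (\max_(s in faces) #|s| = 3)%N;
  positive_triangle : forall a b c, positive a b c ->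
    uniq [:: a; b; c] /\ [set a; b; c]%SET \in faces;
  positive_cycle : forall a b c, positive a b c -> positive b c a;
  positive_total : forall a b c,
    uniq [:: a; b; c] -> [set a; b; c]%SET \in faces ->
    positive a b c = ~~ positive b a c;
  positive_coherent : forall a b c d,
    positive a b c -> positive a b d -> c = d;
  faces_disk : exists f g,
    homeomorphism (@realization R _ faces) (@closed_disk R) f g }.

Section Conditions.
Variables (R : realType) (T : oriented_disk R).
Implicit Types (S : {set {set Vert T}}) (C : {set Vert T}).

Definition edges : {set {set Vert T}} := [set s in faces T | #|s| == 2%N]%SET.

Definition triangles : {set {set Vert T}} := [set s in faces T | #|s| == 3%N]%SET.

(* The vertices on the boundary of the disk [|T|]. By invariance of domain, any
   homeomorphism between [|T|] and the closed disk detects the same vertices. *)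
Definition corners : {set Vert T} :=
  [set v | `[< exists f g,
     homeomorphism (@realization R _ (faces T)) (@closed_disk R) f g /\
     unit_circle (f (@vertex_point R _ v)) >]]%SET.

Definition share_edge : rel {set Vert T} := fun s t =>
  (s != t) && [exists e in edges, (e \subset s) && (e \subset t)].

Definition contiguous S : Prop :=
  forall s t, s \in S -> t \in S ->
    connect [rel x y | [&& x \in S, y \in S & share_edge x y]] s t.

Definition condition C : Prop :=
  C = finset.set0 \/
  exists S, [/\ S \subset triangles, contiguous S, C = finset.cover S
              & (#|C :&: corners| <= 2)%N].

End Conditions.

Record triangulation (R : realType) := Triangulation {
  tri_complex : oriented_disk R;
  tri_condition : {set Vert tri_complex};
  tri_conditionP : condition tri_condition }.

Definition affine_line (K : fieldType) (l : set 'rV[K]_2) : Prop :=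
  exists p d : 'rV[K]_2, d != 0 /\ l = [set p + t *: d | t in [set: K]].

Section Zariski.
Variables (K : fieldType) (V : finType).
Implicit Types X Z : set (V -> 'rV[K]_2).

(* The coordinates of a map [V -> K^2], numbered by ['I_(2 #|V|)] through an
   enumeration of the pairs (vertex, coordinate index). *)
Definition coords (rho : V -> 'rV[K]_2) (i : 'I_#|{: V * 'I_2}|) : K :=
  rho (enum_val i).1 0 (enum_val i).2.

Definition zariski_closed Z : Prop :=
  exists P : set (mpoly #|{: V * 'I_2}| K),
    Z = [set rho | forall p, P p -> meval (coords rho) p = 0].

Definition irreducible_variety X : Prop :=
  [/\ zariski_closed X, X !=set0 &
      forall Z1 Z2, zariski_closed Z1 -> zariski_closed Z2 ->
        X = Z1 `|` Z2 -> X = Z1 \/ X = Z2].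

End Zariski.

Definition drawings (R : realType) (T : triangulation R) :
    set (Vert (tri_complex T) -> 'rV[R[i]]_2) :=
  [set rho | exists l : set 'rV[R[i]]_2, affine_line l /\
     forall v, v \in tri_condition T -> l (rho v)].
Arguments drawings {R} T _.

(* Main.v *)
(* The maps sending C into a line are those of the form v |-> p + t_v d on C,
   with d = 0 allowed, and arbitrary off C; hence X is the image of an affine
   space under a polynomial map, and segments of parameters give polynomial
   curves in X joining any two of its points. If X is the union of two proper
   closed subsets Z1 and Z2, take a polynomial vanishing on Z1 but not at x in X
   and one vanishing on Z2 but not at y in X. Their product vanishes along a
   curve from x to y, although neither factor does, which is impossible for
   univariate polynomials over an infinite field. Closedness is the vanishing of
   the 2x2 determinants det(rho v - rho u, rho w - rho u) for u, v, w in C. *)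

Require Import Defs.
From mathcomp Require Import all_boot all_order all_algebra.
From mathcomp Require Import all_classical all_reals all_analysis.
From mathcomp Require Import complex.
From mathcomp Require Import ring.
From mathcomp Require Import -(notations) mpoly.

Set Implicit Arguments.
Unset Strict Implicit.
Unset Printing Implicit Defensive.

Import Order.TTheory GRing.Theory Num.Theory.

Local Open Scope classical_set_scope.
Local Open Scope ring_scope.

Lemma row2P (K : Type) (x y : 'rV[K]_2) : x 0 0 = y 0 0 -> x 0 1 = y 0 1 -> x = y.
Proof.
move=> x0 x1; apply/rowP => -[[|[|//]] ltj2].
  by rewrite (_ : Ordinal ltj2 = 0) //; exact: val_inj.
by rewrite (_ : Ordinal ltj2 = 1) //; exact: val_inj.
Qed.

Lemma horner_mmap (K : comNzRingType) n (h : 'I_n -> {poly K}) (p : mpoly n K) s :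
  (mmap polyC h p).[s] = meval (fun i => (h i).[s]) p.
Proof.
rewrite mevalE /mmap horner_sum; apply: eq_bigr => m _.
rewrite hornerM hornerC /mmap1 horner_prod; congr (_ * _).
by apply: eq_bigr => i _; rewrite horner_exp.
Qed.

(** In characteristic zero the naturals below [size q] are distinct, which is one root too many for
    a nonzero [q]. *)
Lemma poly_vanish (K : numDomainType) (q : {poly K}) :
  (forall s, q.[s] = 0) -> q = 0.
Proof.
move=> q0; apply/eqP; apply: contraT => qn0.
have := @max_poly_roots _ q [seq i%:R | i <- iota 0 (size q)] qn0.
rewrite size_map size_iota ltnn => -> //.
  by apply/allP => x _; apply/eqP/q0.
by rewrite map_inj_uniq ?iota_uniq// => i j /eqP; rewrite eqr_nat => /eqP.
Qed.

Section Curves.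
Variables (K : numFieldType) (V : finType).
Implicit Types X Z : set (V -> 'rV[K]_2).

Definition curve_point (c : V -> 'I_2 -> {poly K}) (s : K) : V -> 'rV[K]_2 :=
  fun v => \row_j (c v j).[s].

Definition curve_poly (c : V -> 'I_2 -> {poly K}) (p : mpoly #|{: V * 'I_2}| K) :=
  mmap polyC (fun i => c (enum_val i).1 (enum_val i).2) p.

Lemma horner_curve_poly c p s :
  (curve_poly c p).[s] = meval (coords (curve_point c s)) p.
Proof.
rewrite horner_mmap; apply: meval_eq => i.
by rewrite /coords mxE.
Qed.

Lemma irreducible_of_curves X :
  zariski_closed X -> X !=set0 ->
  (forall x y, X x -> X y -> exists c,
     [/\ curve_point c 0 = x, curve_point c 1 = y &
         forall s, X (curve_point c s)]) ->
  irreducible_variety X.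
Proof.
move=> Xclosed X0 Xcurve; split=> // Z1 Z2 [P1 Z1E] [P2 Z2E] XE.
apply: contrapT => /not_orP[XZ1 XZ2].
(* Stated for generic [Z] so as to serve both components, the second after swapping the union. *)
have sep P Z Z' : X = Z `|` Z' -> X <> Z ->
    Z = [set rho | forall p, P p -> meval (coords rho) p = 0] ->
    exists x p, [/\ X x, P p & meval (coords x) p != 0].
  move=> XU XZ ZE; apply: contrapT => nex; apply: XZ.
  apply/seteqP; split=> [x Xx|x Zx]; last by rewrite XU; left.
  rewrite ZE => p Pp; apply: contrapT => /eqP px; apply: nex.
  by exists x, p.
have [x [p [Xx P1p px]]] := sep _ _ _ XE XZ1 Z1E.
have [y [q [Xy P2q qy]]] := sep _ _ _ (etrans XE (setUC _ _)) XZ2 Z2E.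
have [c [c0 c1 Xc]] := Xcurve x y Xx Xy.
have /eqP : curve_poly c p * curve_poly c q = 0.
  (* Which factor vanishes may depend on [s]; only the product vanishes at every [s]. *)
  apply: poly_vanish => s; rewrite hornerM !horner_curve_poly; apply/eqP.
  rewrite mulf_eq0; have := Xc s; rewrite XE Z1E Z2E => -[] /=.
    by move=> /(_ _ P1p) ->; rewrite eqxx.
  by move=> /(_ _ P2q) ->; rewrite eqxx orbT.
rewrite mulf_eq0 => /orP[] /eqP c_eq0.
  by move: px; rewrite -c0 -horner_curve_poly c_eq0 horner0 eqxx.
by move: qy; rewrite -c1 -horner_curve_poly c_eq0 horner0 eqxx.
Qed.

End Curves.

Section Collinear.
Variables (K : numFieldType) (V : finType) (C : {set V}).

Definition collinear_on : set (V -> 'rV[K]_2) :=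
  [set rho | exists l : set 'rV[K]_2, affine_line l /\
     forall v, v \in C -> l (rho v)].

(* Allowing the zero direction makes the parameter space an affine space. *)
Lemma collinear_onP (rho : V -> 'rV[K]_2) :
  collinear_on rho <->
  exists (p d : 'rV[K]_2) (t : V -> K), forall v, v \in C -> rho v = p + t v *: d.
Proof.
split=> [[l [[p [d [_ ->]]] lC]]|[p [d [t rhoE]]]].
  have /choice[t tP] v : exists t, v \in C -> rho v = p + t *: d.
    have [/lC[t _ <-]|_] := boolP (v \in C); last by exists 0.
    by exists t.
  by exists p, d, t.
have [d0|dn0] := eqVneq d 0.
  (* All points of [C] are sent to [p], so any line through [p] works; [const_mx 1] is an arbitrary
     nonzero direction. *)
  exists [set p + t *: const_mx 1 | t in [set: K]]; split.
    exists p, (const_mx 1); split=> //; apply/eqP => /matrixP/(_ 0 0).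
    by rewrite !mxE => /eqP; rewrite oner_eq0.
  by move=> v /rhoE ->; exists 0 => //; rewrite d0 scaler0 scale0r.
exists [set p + t *: d | t in [set: K]]; split; first by exists p, d.
by move=> v /rhoE ->; exists (t v).
Qed.

Definition coord_var (v : V) (j : 'I_2) : mpoly #|{: V * 'I_2}| K :=
  mpolyX K (mnm1 (enum_rank (v, j))).

Definition area_poly (u v w : V) : mpoly #|{: V * 'I_2}| K :=
  (coord_var v 0 - coord_var u 0) * (coord_var w 1 - coord_var u 1) -
  (coord_var v 1 - coord_var u 1) * (coord_var w 0 - coord_var u 0).

Lemma meval_area_poly rho u v w : meval (coords rho) (area_poly u v w) =
  (rho v 0 0 - rho u 0 0) * (rho w 0 1 - rho u 0 1) -
  (rho v 0 1 - rho u 0 1) * (rho w 0 0 - rho u 0 0).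
Proof.
by rewrite !(mevalB, mevalM, mevalXU) /coords !enum_rankK.
Qed.

Lemma collinear_on_closed : zariski_closed collinear_on.
Proof.
exists [set p | exists u v w, [/\ u \in C, v \in C, w \in C & p = area_poly u v w]].
apply/seteqP; split=> rho.
  move=> /collinear_onP[p [d [t rhoE]]] _ [u [v [w [uC vC wC ->]]]].
  (* Both difference vectors are multiples of [d], so their determinant is zero. *)
  by rewrite meval_area_poly !rhoE // !mxE; ring.
move=> /= area0; apply/collinear_onP.
have [->|[u uC]] := set_0Vmem C.
  by exists 0, 0, (fun=> 0) => v; rewrite inE.
(* Two distinct image points determine the line; if there are none, the zero direction does. *)
have [[v vC vu]|const] := pselect (exists2 v, v \in C & rho v != rho u); last first.
  exists (rho u), 0, (fun=> 0) => v vC; rewrite scaler0 addr0.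
  by apply: contrapT => /eqP vu; apply: const; exists v.
have area w : w \in C ->
  (rho v 0 0 - rho u 0 0) * (rho w 0 1 - rho u 0 1) =
  (rho v 0 1 - rho u 0 1) * (rho w 0 0 - rho u 0 0).
  move=> wC; apply/eqP; rewrite -subr_eq0 -meval_area_poly; apply/eqP/area0.
  by exists u, v, w.
(* The parameter of [rho w] is a quotient by a nonzero coordinate of the direction [rho v - rho u];
   [area] settles the other coordinate. *)
have [v0|v0] := eqVneq (rho v 0 0 - rho u 0 0) 0.
  have v1 : rho v 0 1 - rho u 0 1 != 0.
    apply: contraNneq vu => v1; apply/eqP/row2P; exact: subr0_eq.
  exists (rho u), (rho v - rho u),
    (fun w => (rho w 0 1 - rho u 0 1) / (rho v 0 1 - rho u 0 1)) => w wC.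
  have /eqP := area w wC; rewrite v0 mul0r eq_sym mulf_eq0 (negPf v1) /= => /eqP w0.
  apply: row2P; rewrite !mxE.
    by rewrite v0 mulr0 addr0; exact/subr0_eq.
  by rewrite divfK// addrC subrK.
exists (rho u), (rho v - rho u),
  (fun w => (rho w 0 0 - rho u 0 0) / (rho v 0 0 - rho u 0 0)) => w wC.
apply: row2P; rewrite !mxE; first by rewrite divfK// addrC subrK.
by rewrite mulrAC [X in X / _]mulrC -area// mulrAC divff// mul1r addrC subrK.
Qed.

Lemma collinear_on_irreducible : irreducible_variety collinear_on.
Proof.
apply: irreducible_of_curves; first exact: collinear_on_closed.
  exists (fun=> 0); apply/collinear_onP; exists 0, 0, (fun=> 0) => v _.
  by rewrite scaler0 addr0.
move=> x y /collinear_onP[p [d [t xE]]] /collinear_onP[p' [d' [t' yE]]].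
pose seg (a b : K) : {poly K} := a%:P + (b - a) *: 'X.
have segE a b s : (seg a b).[s] = a + s * (b - a).
  by rewrite !hornerE mulrC.
(* On [C] the parameters [p], [d], [t] are interpolated, not the points: straight segments from
   [x v] to [y v] need not preserve collinearity. *)
exists (fun v j => if v \in C
  then seg (p 0 j) (p' 0 j) + seg (t v) (t' v) * seg (d 0 j) (d' 0 j)
  else seg (x v 0 j) (y v 0 j)); split.
- apply/funext => v; apply/rowP => j; rewrite mxE; case: ifPn => vC.
    by rewrite hornerD hornerM !segE xE // !mxE; ring.
  by rewrite segE; ring.
- apply/funext => v; apply/rowP => j; rewrite mxE; case: ifPn => vC.
    by rewrite hornerD hornerM !segE yE // !mxE; ring.
  by rewrite segE; ring.
move=> s; apply/collinear_onP.
(* The interpolated direction may vanish for some [s], which [collinear_onP] permits. *)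
exists (p + s *: (p' - p)), (d + s *: (d' - d)), (fun v => t v + s * (t' v - t v)).
move=> v vC; apply/rowP => j.
by rewrite !mxE vC hornerD hornerM !segE.
Qed.

End Collinear.

Theorem theorem2 (R : realType) (T : triangulation R) :
  irreducible_variety (drawings T).
Proof. exact: collinear_on_irreducible. Qed.
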